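(* Let $E$ be a graph, and let $K$ be a field. Viewing $K$ as a $\mathbb{Z}$-module, we have $$L_K(E) \cong K \otimes_{\mathbb{Z}} L_{\mathbb{Z}}(E)$$ as $K$-algebras. Furthermore, if $K$ has characteristic $p > 0$, then, viewing $K$ as a $\mathbb{Z}_p$-module, $$L_K(E) \cong K \otimes_{\mathbb{Z}_p} L_{\mathbb{Z}_p}(E)$$ as $K$-algebras.
   Context: Graphs: a graph is a directed graph $E=(E^0,E^1,r,s)$ with countable sets $E^0$ (vertices), $E^1$ (edges) and maps $r,s:E^1\to E^0$ (range, source). A vertex $v$ is regular, $v\in E^0_{\mathrm{reg}}$, if $0<|s^{-1}(v)|<\infty$. Rings are not assumed commutative or unital. For $R$ a commutative ring with unit $1$, an $R$-algebra is a ring $A$ that is also a left $R$-module with $\lambda(xy)=(\lambda x)y=x(\lambda y)$ and $1\cdot x=x$; homomorphisms of $R$-algebras are $R$-linear ring homomorphisms. A Leavitt $E$-family in a ring is a collection $\{v,e,e^*:v\in E^0,e\in E^1\}$ of elements such that the $v$'s are pairwise orthogonal idempotents and: (1) $s(e)e=er(e)=e$; (2) $r(e)e^*=e^*s(e)=e^*$; (3) $e^*f=\delta_{e,f}\,r(e)$ for all $e,f\in E^1$; (4) $v=\sum_{s(e)=v}ee^*$ for every $v\in E^0_{\mathrm{reg}}$. For a commutative ring $R$ with unit, the Leavitt path algebra $L_R(E)$ is the universal $R$-algebra generated by a Leavitt $E$-family $\{v,e,e^*\}$: every Leavitt $E$-family $\{a_v,b_e,c_{e^*}\}$ in an $R$-algebra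 $A$ is the image of the generators under an $R$-algebra homomorphism $L_R(E)\to A$ with $v\mapsto a_v$, $e\mapsto b_e$, $e^*\mapsto c_{e^*}$. $\mathbb{Z}_p=\mathbb{Z}/p\mathbb{Z}$. The tensor product $A\otimes_S B$ of $S$-algebras carries the multiplication $(a_1\otimes b_1)(a_2\otimes b_2)=a_1a_2\otimes b_1b_2$, and $K\otimes_S A$ is a $K$-algebra via $k_1(k_2\otimes a)=k_1k_2\otimes a$. *)

(* Defs.v *)
From HB Require Import structures.
From mathcomp Require Import all_boot all_algebra generic_quotient finfield.
From mathcomp Require Import boolp classical_sets cardinality fsbigop.
Set Implicit Arguments.
Unset Strict Implicit.
Unset Printing Implicit Defensive.
Import GRing.Theory.
Local Open Scope classical_set_scope.
Local Open Scope quotient_scope.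
Local Open Scope ring_scope.

(* Algebras, possibly without unit and not necessarily commutative; this is   *)
(* weaker than MathComp's algType, whose multiplication has a unit.           *)

HB.mixin Record Lmodule_isNuAlgebra (R : pzRingType) A of GRing.Lmodule R A := {
  numul : A -> A -> A;
  numulA : associative numul;
  numulDl : left_distributive numul +%R;
  numulDr : right_distributive numul +%R;
  numulZl : forall (a : R) (x y : A), numul (a *: x) y = a *: numul x y;
  numulZr : forall (a : R) (x y : A), numul x (a *: y) = a *: numul x y
}.

#[short(type="nuAlgType")]
HB.structure Definition NuAlgebra (R : pzRingType) :=
  {A of GRing.Lmodule R A & Lmodule_isNuAlgebra R A}.

Notation "x ** y" := (numul x y) (at level 40, left associativity) : ring_scope.

Definition nualg_isomorphic (R : pzRingType) (A B : nuAlgType R) : Prop :=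
  exists2 f : {linear A -> B}, {morph f : x y / x ** y} & bijective f.

Record graph := Graph {
  vertex : countType;
  edge : countType;
  esource : edge -> vertex;
  erange : edge -> vertex
}.

Definition out_edges (E : graph) (v : vertex E) : set (edge E) :=
  [set e | esource e = v].

Definition regular (E : graph) (v : vertex E) : Prop :=
  out_edges v !=set0 /\ finite_set (out_edges v).

(* [c e] is the image of the ghost edge e^*. *)
Record leavitt_family (R : pzRingType) (E : graph) (A : nuAlgType R)
    (a : vertex E -> A) (b c : edge E -> A) : Prop := LeavittFamily {
  lf_idem : forall v, a v ** a v = a v;
  lf_orth : forall v w, v != w -> a v ** a w = 0;
  lf_source : forall e, a (esource e) ** b e = b e;
  lf_range : forall e, b e ** a (erange e) = b e;
  lf_ghost_range : forall e, a (erange e) ** c e = c e;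
  lf_ghost_source : forall e, c e ** a (esource e) = c e;
  lf_ck1 : forall e f, c e ** b f = if e == f then a (erange e) else 0;
  lf_ck2 : forall v, regular v -> a v = \sum_(e \in out_edges v) (b e ** c e)
}.

Inductive lpa_term (R : Type) (E : graph) : Type :=
  | TVertex of vertex E
  | TEdge of edge E
  | TGhost of edge E
  | TZero
  | TAdd of lpa_term R E & lpa_term R E
  | TScale of R & lpa_term R E
  | TMul of lpa_term R E & lpa_term R E.
Arguments TVertex {R E}.
Arguments TEdge {R E}.
Arguments TGhost {R E}.
Arguments TZero {R E}.

HB.instance Definition _ (R : Type) (E : graph) := gen_eqMixin (lpa_term R E).
HB.instance Definition _ (R : Type) (E : graph) :=
  gen_choiceMixin (lpa_term R E).

Section LeavittPathAlgebra.
Variables (R : comPzRingType) (E : graph).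

Section Eval.
Variables (A : nuAlgType R) (a : vertex E -> A) (b c : edge E -> A).

Fixpoint term_eval (t : lpa_term R E) : A :=
  match t with
  | TVertex v => a v
  | TEdge e => b e
  | TGhost e => c e
  | TZero => 0
  | TAdd t u => term_eval t + term_eval u
  | TScale k t => k *: term_eval t
  | TMul t u => term_eval t ** term_eval u
  end.
End Eval.

(* Terms are identified exactly when they take the same value on every        *)
(* Leavitt E-family in every R-algebra; the quotient is therefore the         *)
(* universal R-algebra generated by a Leavitt E-family, see [lpa_leavitt],    *)
(* [lpa_lift] and [lpa_lift_unique] below.                                    *)
Definition lpa_equiv (t u : lpa_term R E) : Prop :=
  forall (A : nuAlgType R) (a : vertex E -> A) (b c : edge E -> A),
    leavitt_family a b c -> term_eval a b c t = term_eval a b c u.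

Definition lpa_rel : rel (lpa_term R E) := fun t u => `[< lpa_equiv t u >].

Lemma lpa_rel_refl : reflexive lpa_rel.
Proof. by move=> t; apply/asboolP => A a b c _. Qed.

Lemma lpa_rel_sym : symmetric lpa_rel.
Proof.
by move=> t u; apply/asboolP/asboolP => tu A a b c fam; rewrite (tu A a b c).
Qed.

Lemma lpa_rel_trans : transitive lpa_rel.
Proof.
move=> t u w /asboolP ut /asboolP tw; apply/asboolP => A a b c fam.
by rewrite (ut A a b c) // (tw A a b c).
Qed.

Canonical lpa_equiv_rel :=
  EquivRel lpa_rel lpa_rel_refl lpa_rel_sym lpa_rel_trans.

Definition lpa : Type := {eq_quot lpa_equiv_rel}.
HB.instance Definition _ := Choice.on lpa.
HB.instance Definition _ := EqQuotient.on lpa.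

Definition lpa_class (t : lpa_term R E) : lpa := \pi_lpa t.
Definition lpa_repr (x : lpa) : lpa_term R E :=
  repr x.

Section Value.
Variables (A : nuAlgType R) (a : vertex E -> A) (b c : edge E -> A).

Definition lpa_value (x : lpa) : A := term_eval a b c (lpa_repr x).

Lemma lpa_value_class t :
  leavitt_family a b c -> lpa_value (lpa_class t) = term_eval a b c t.
Proof.
move=> fam; have /eqmodP/asboolP h :
  (lpa_repr (lpa_class t) = t %[mod lpa]).
  exact: reprK.
exact: h.
Qed.
End Value.

Lemma lpa_ext (x y : lpa) :
  (forall (A : nuAlgType R) (a : vertex E -> A) (b c : edge E -> A),
    leavitt_family a b c -> lpa_value a b c x = lpa_value a b c y) -> x = y.
Proof.
move=> h; have <- : lpa_class (lpa_repr x) = x by exact: reprK.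
have <- : lpa_class (lpa_repr y) = y by exact: reprK.
by apply/eqmodP/asboolP => A a b c /h.
Qed.

Definition lpa_zero : lpa := lpa_class TZero.
Definition lpa_add (x y : lpa) : lpa :=
  lpa_class (TAdd (lpa_repr x) (lpa_repr y)).
Definition lpa_scale (k : R) (x : lpa) : lpa :=
  lpa_class (TScale k (lpa_repr x)).
Definition lpa_opp : lpa -> lpa := lpa_scale (-1).
Definition lpa_mul (x y : lpa) : lpa :=
  lpa_class (TMul (lpa_repr x) (lpa_repr y)).

Section ValueMorphism.
Variables (A : nuAlgType R) (a : vertex E -> A) (b c : edge E -> A).
Hypothesis fam : leavitt_family a b c.
Local Notation value := (lpa_value a b c).

Lemma lpa_value0 : value lpa_zero = 0.
Proof. exact: lpa_value_class. Qed.

Lemma lpa_valueD x y : value (lpa_add x y) = value x + value y.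
Proof. exact: lpa_value_class. Qed.

Lemma lpa_valueZ k x : value (lpa_scale k x) = k *: value x.
Proof. exact: lpa_value_class. Qed.

Lemma lpa_valueN x : value (lpa_opp x) = - value x.
Proof. by rewrite lpa_valueZ scaleN1r. Qed.

Lemma lpa_valueM x y : value (lpa_mul x y) = value x ** value y.
Proof. exact: lpa_value_class. Qed.

Definition lpa_valueE :=
  (lpa_value0, lpa_valueD, lpa_valueZ, lpa_valueN, lpa_valueM).
End ValueMorphism.

Lemma lpa_addA : associative lpa_add.
Proof.
by move=> x y z; apply: lpa_ext => A a b c fam; rewrite !lpa_valueE // addrA.
Qed.

Lemma lpa_addC : commutative lpa_add.
Proof.
by move=> x y; apply: lpa_ext => A a b c fam; rewrite !lpa_valueE // addrC.
Qed.

Lemma lpa_add0 : left_id lpa_zero lpa_add.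
Proof.
by move=> x; apply: lpa_ext => A a b c fam; rewrite !lpa_valueE // add0r.
Qed.

Lemma lpa_addN : left_inverse lpa_zero lpa_opp lpa_add.
Proof.
by move=> x; apply: lpa_ext => A a b c fam; rewrite !lpa_valueE // addNr.
Qed.

HB.instance Definition _ :=
  GRing.isZmodule.Build lpa lpa_addA lpa_addC lpa_add0 lpa_addN.

Lemma lpa_scaleA k l x : lpa_scale k (lpa_scale l x) = lpa_scale (k * l) x.
Proof.
by apply: lpa_ext => A a b c fam; rewrite !lpa_valueE // scalerA.
Qed.

Lemma lpa_scale1 : left_id 1 lpa_scale.
Proof.
by move=> x; apply: lpa_ext => A a b c fam; rewrite !lpa_valueE // scale1r.
Qed.

Lemma lpa_scaleDr : right_distributive lpa_scale +%R.
Proof.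
by move=> k x y; apply: lpa_ext => A a b c fam; rewrite !lpa_valueE // scalerDr.
Qed.

Lemma lpa_scaleDl x : {morph lpa_scale^~ x : k l / k + l}.
Proof.
by move=> k l; apply: lpa_ext => A a b c fam; rewrite !lpa_valueE // scalerDl.
Qed.

HB.instance Definition _ := GRing.Zmodule_isLmodule.Build R lpa
  lpa_scaleA lpa_scale1 lpa_scaleDr lpa_scaleDl.

Lemma lpa_mulA : associative lpa_mul.
Proof.
by move=> x y z; apply: lpa_ext => A a b c fam; rewrite !lpa_valueE // numulA.
Qed.

Lemma lpa_mulDl : left_distributive lpa_mul +%R.
Proof.
by move=> x y z; apply: lpa_ext => A a b c fam; rewrite !lpa_valueE // numulDl.
Qed.

Lemma lpa_mulDr : right_distributive lpa_mul +%R.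
Proof.
by move=> x y z; apply: lpa_ext => A a b c fam; rewrite !lpa_valueE // numulDr.
Qed.

Lemma lpa_mulZl (k : R) (x y : lpa) : lpa_mul (k *: x) y = k *: lpa_mul x y.
Proof.
by apply: lpa_ext => A a b c fam; rewrite !lpa_valueE // numulZl.
Qed.

Lemma lpa_mulZr (k : R) (x y : lpa) : lpa_mul x (k *: y) = k *: lpa_mul x y.
Proof.
by apply: lpa_ext => A a b c fam; rewrite !lpa_valueE // numulZr.
Qed.

HB.instance Definition _ := Lmodule_isNuAlgebra.Build R lpa
  lpa_mulA lpa_mulDl lpa_mulDr lpa_mulZl lpa_mulZr.

Definition lpa_vertex (v : vertex E) : lpa := lpa_class (TVertex v).
Definition lpa_edge (e : edge E) : lpa := lpa_class (TEdge e).
Definition lpa_ghost (e : edge E) : lpa := lpa_class (TGhost e).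

Lemma lpa_classE t : lpa_class t = term_eval lpa_vertex lpa_edge lpa_ghost t.
Proof.
elim: t => //= [t <- u <-|k t <-|t <- u <-];
  by apply: lpa_ext => A a b c fam; rewrite ?lpa_valueE // !lpa_value_class.
Qed.

Lemma lpa_sum_value (A : nuAlgType R) (a : vertex E -> A) (b c : edge E -> A)
    (I : Type) (r : seq I) (F : I -> lpa) : leavitt_family a b c ->
  lpa_value a b c (\sum_(i <- r) F i) = \sum_(i <- r) lpa_value a b c (F i).
Proof.
move=> fam; elim: r => [|i r IHr]; first by rewrite !big_nil lpa_value0.
by rewrite !big_cons lpa_valueD // IHr.
Qed.

Lemma lpa_leavitt : leavitt_family lpa_vertex lpa_edge lpa_ghost.
Proof.
split=> [v|v w vw|e|e|e|e|e f|v rv];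
    apply: lpa_ext => A a b c fam; rewrite ?lpa_valueE // ?lpa_value_class //=.
- exact: lf_idem fam _.
- exact: lf_orth fam _ _ vw.
- exact: lf_source fam _.
- exact: lf_range fam _.
- exact: lf_ghost_range fam _.
- exact: lf_ghost_source fam _.
- rewrite (lf_ck1 fam); case: eqP => _; last by rewrite lpa_value0.
  by rewrite lpa_value_class.
have [_ fin_v] := rv.
rewrite (lf_ck2 fam rv) !fsbig_finite //= lpa_sum_value //.
by apply: eq_bigr => e _; rewrite lpa_valueM // !lpa_value_class.
Qed.

Lemma lpa_lift (A : nuAlgType R) (a : vertex E -> A) (b c : edge E -> A) :
  leavitt_family a b c ->
  exists f : {linear lpa -> A}, [/\ {morph f : x y / x ** y},
    forall v, f (lpa_vertex v) = a v,
    forall e, f (lpa_edge e) = b e & forall e, f (lpa_ghost e) = c e].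
Proof.
move=> fam; have lin : linear (lpa_value a b c).
  by move=> k x y; rewrite lpa_valueD // lpa_valueZ.
pose fM := GRing.isLinear.Build R lpa A *:%R (lpa_value a b c) lin.
pose f : {linear lpa -> A} := HB.pack (lpa_value a b c) fM.
by exists f; split=> [x y|v|e|e]; rewrite /= ?lpa_valueM // lpa_value_class.
Qed.

Lemma lpa_lift_unique (A : nuAlgType R) (f g : {linear lpa -> A}) :
  {morph f : x y / x ** y} -> {morph g : x y / x ** y} ->
  (forall v, f (lpa_vertex v) = g (lpa_vertex v)) ->
  (forall e, f (lpa_edge e) = g (lpa_edge e)) ->
  (forall e, f (lpa_ghost e) = g (lpa_ghost e)) -> f =1 g.
Proof.
move=> fM gM fgv fge fgg x.
have <- : lpa_class (lpa_repr x) = x by exact: reprK.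
rewrite lpa_classE.
elim: (lpa_repr x) => /= [//|//|//||t IHt u IHu|k t IHt|t IHt u IHu].
- by rewrite !linear0.
- by rewrite !linearD IHt IHu.
- by rewrite !linearZ IHt.
- by rewrite fM gM IHt IHu.
Qed.
End LeavittPathAlgebra.

(* Tensor product of modules over a commutative ring: formal sums of pairs,   *)
(* two of which are identified exactly when every balanced biadditive map     *)
(* into an abelian group takes the same value on both.                        *)
(* See [pure_balanced], [tensor_value_pure] and [tensor_ind] below for its     *)
(* universal property.                                                        *)

Definition balanced (S : comPzRingType) (M N : lmodType S) (P : zmodType)
    (f : M -> N -> P) : Prop :=
  [/\ forall n, {morph f^~ n : x y / x + y},
      forall m, {morph f m : x y / x + y} &
      forall (s : S) m n, f (s *: m) n = f m (s *: n)].

Section Tensor.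
Variables (S : comPzRingType) (M N : lmodType S).

Definition formal_value (P : zmodType) (f : M -> N -> P)
    (s : seq (M * N)) : P :=
  \sum_(x <- s) f x.1 x.2.

Definition tensor_equiv (s t : seq (M * N)) : Prop :=
  forall (P : zmodType) (f : M -> N -> P),
    balanced f -> formal_value f s = formal_value f t.

Definition tensor_rel : rel (seq (M * N)) := fun s t => `[< tensor_equiv s t >].

Lemma tensor_rel_refl : reflexive tensor_rel.
Proof. by move=> s; apply/asboolP. Qed.

Lemma tensor_rel_sym : symmetric tensor_rel.
Proof. by move=> s t; apply/asboolP/asboolP => st P f fb; rewrite (st P f). Qed.

Lemma tensor_rel_trans : transitive tensor_rel.
Proof.
move=> t s u /asboolP st /asboolP tu; apply/asboolP => P f fb.
by rewrite (st P f) // (tu P f).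
Qed.

Canonical tensor_equiv_rel :=
  EquivRel tensor_rel tensor_rel_refl tensor_rel_sym tensor_rel_trans.

Definition tensor : Type := {eq_quot tensor_equiv_rel}.
HB.instance Definition _ := Choice.on tensor.
HB.instance Definition _ := EqQuotient.on tensor.

Definition tensor_class (s : seq (M * N)) : tensor :=
  \pi_tensor s.
Definition tensor_repr (x : tensor) : seq (M * N) :=
  repr x.

Definition pure (m : M) (n : N) : tensor := tensor_class [:: (m, n)].

Lemma tensor_reprK : cancel tensor_repr tensor_class.
Proof. exact: reprK. Qed.

Definition tensor_value (P : zmodType) (f : M -> N -> P) (x : tensor) : P :=
  formal_value f (tensor_repr x).

Lemma tensor_value_class (P : zmodType) (f : M -> N -> P) s :
  balanced f -> tensor_value f (tensor_class s) = formal_value f s.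
Proof.
move=> fb; have /eqmodP/asboolP h :
  (tensor_repr (tensor_class s) = s %[mod tensor]).
  exact: reprK.
exact: h.
Qed.

Lemma tensor_ext (x y : tensor) :
  (forall (P : zmodType) (f : M -> N -> P),
    balanced f -> tensor_value f x = tensor_value f y) -> x = y.
Proof.
move=> h; rewrite -(tensor_reprK x) -(tensor_reprK y).
by apply/eqmodP/asboolP => P f /h.
Qed.

Definition tensor_zero : tensor := tensor_class [::].
Definition tensor_add (x y : tensor) : tensor :=
  tensor_class (tensor_repr x ++ tensor_repr y).
Definition tensor_opp (x : tensor) : tensor :=
  tensor_class [seq (- u.1, u.2) | u <- tensor_repr x].

Section Value.
Variables (P : zmodType) (f : M -> N -> P).
Hypothesis fb : balanced f.

Lemma tensor_value0 : tensor_value f tensor_zero = 0.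
Proof. by rewrite tensor_value_class // /formal_value big_nil. Qed.

Lemma tensor_valueD x y :
  tensor_value f (tensor_add x y) = tensor_value f x + tensor_value f y.
Proof. by rewrite tensor_value_class // /formal_value big_cat. Qed.

Lemma balanced0l n : f 0 n = 0.
Proof. by have [fD _ _] := fb; apply: (addrI (f 0 n)); rewrite -fD !addr0. Qed.

Lemma balancedNl m n : f (- m) n = - f m n.
Proof.
by have [fD _ _] := fb; apply/eqP; rewrite -addr_eq0 -fD addNr balanced0l.
Qed.

Lemma tensor_valueN x : tensor_value f (tensor_opp x) = - tensor_value f x.
Proof.
rewrite tensor_value_class // /formal_value big_map -sumrN.
by apply: eq_bigr => u _; exact: balancedNl.
Qed.

Lemma tensor_value_pure m n : tensor_value f (pure m n) = f m n.
Proof. by rewrite tensor_value_class // /formal_value big_seq1. Qed.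

End Value.

Lemma tensor_addA : associative tensor_add.
Proof.
by move=> x y z; apply: tensor_ext => P f fb; rewrite !tensor_valueD // addrA.
Qed.

Lemma tensor_addC : commutative tensor_add.
Proof.
by move=> x y; apply: tensor_ext => P f fb; rewrite !tensor_valueD // addrC.
Qed.

Lemma tensor_add0 : left_id tensor_zero tensor_add.
Proof.
move=> x; apply: tensor_ext => P f fb.
by rewrite tensor_valueD // tensor_value0 // add0r.
Qed.

Lemma tensor_addN : left_inverse tensor_zero tensor_opp tensor_add.
Proof.
move=> x; apply: tensor_ext => P f fb.
by rewrite tensor_valueD // tensor_valueN // tensor_value0 // addNr.
Qed.

HB.instance Definition _ :=
  GRing.isZmodule.Build tensor tensor_addA tensor_addC tensor_add0 tensor_addN.

Lemma pure_balanced : balanced pure.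
Proof.
split=> [n x y|m x y|s m n]; apply: tensor_ext => P f fb;
  have [fDl fDr fS] := fb.
- by rewrite [RHS]tensor_valueD // !tensor_value_pure // fDl.
- by rewrite [RHS]tensor_valueD // !tensor_value_pure // fDr.
- by rewrite !tensor_value_pure // fS.
Qed.

Lemma tensor_classE s : tensor_class s = \sum_(u <- s) pure u.1 u.2.
Proof.
elim: s => [|u s IHs]; first by rewrite big_nil.
rewrite big_cons -IHs; apply: tensor_ext => P f fb.
rewrite tensor_valueD // tensor_value_pure // !tensor_value_class //.
by rewrite /formal_value big_cons.
Qed.

Lemma tensor_ind (Q : tensor -> Prop) :
  Q 0 -> (forall x y, Q x -> Q y -> Q (x + y)) ->
  (forall m n, Q (pure m n)) -> forall x, Q x.
Proof.
move=> Q0 QD Qp x; rewrite -(tensor_reprK x) tensor_classE.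
by elim/big_ind: _.
Qed.

Lemma tensor_value_additive (P : zmodType) (f : M -> N -> P) :
  balanced f -> {morph tensor_value f : x y / x + y}.
Proof. by move=> fb x y; exact: tensor_valueD. Qed.

End Tensor.
Arguments pure {S M N}.

(* K \otimes_S A as a K-algebra, for a commutative S-algebra K with unit.     *)
Section ScalarExtension.
Variables (S : comPzRingType) (K : comAlgType S) (A : nuAlgType S).

Definition scalar_extension : Type := tensor K A.
HB.instance Definition _ := GRing.Zmodule.on scalar_extension.

Implicit Types x y z : scalar_extension.

Definition ext_scale (k : K) x : scalar_extension :=
  tensor_value (fun k' a => pure (k * k') a) x.

Definition ext_mul x y : scalar_extension :=
  tensor_value (fun k a => tensor_value (fun l b => pure (k * l) (a ** b)) y) x.

Lemma ext_scale_balanced (k : K) :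
  balanced (fun (k' : K) (a : A) => pure (k * k') a).
Proof.
have [bDl bDr bS] := @pure_balanced S K A.
split=> [a x y|k' x y|s k' a]; first by rewrite mulrDr bDl.
  exact: bDr.
by rewrite -scalerAr bS.
Qed.

Lemma ext_mul_balanced_r (k : K) (a : A) :
  balanced (fun (l : K) (b : A) => pure (k * l) (a ** b)).
Proof.
have [bDl bDr bS] := @pure_balanced S K A.
split=> [b x y|l x y|s l b]; first by rewrite mulrDr bDl.
  by rewrite numulDr bDr.
by rewrite -scalerAr bS numulZr.
Qed.

Lemma tensor_valueDf (P : zmodType) (f g h : K -> A -> P) x :
  (forall k a, f k a = g k a + h k a) ->
  tensor_value f x = tensor_value g x + tensor_value h x.
Proof. by move=> fgh; rewrite -big_split; apply: eq_bigr => u _. Qed.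

Lemma eq_tensor_value (P : zmodType) (f g : K -> A -> P) x :
  (forall k a, f k a = g k a) -> tensor_value f x = tensor_value g x.
Proof. by move=> fg; apply: eq_bigr => u _. Qed.

Lemma ext_mul_balanced_l y : balanced (fun (k : K) (a : A) =>
  tensor_value (fun (l : K) (b : A) => pure (k * l) (a ** b)) y).
Proof.
have [bDl bDr bS] := @pure_balanced S K A.
split=> [a k l|k a b|s k a].
- by apply: tensor_valueDf => m c; rewrite mulrDl bDl.
- by apply: tensor_valueDf => m c; rewrite numulDl bDr.
- by apply: eq_tensor_value => m c; rewrite -scalerAl bS numulZl.
Qed.

Lemma ext_scaleD (k : K) : {morph ext_scale k : x y / x + y}.
Proof. exact: tensor_value_additive (ext_scale_balanced k). Qed.

Lemma ext_scale_pure (k l : K) (a : A) :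
  ext_scale k (pure l a) = pure (k * l) a.
Proof. exact: tensor_value_pure (ext_scale_balanced k) _ _. Qed.

Lemma ext_mulDl : left_distributive ext_mul +%R.
Proof.
by move=> x y z; exact: tensor_value_additive (ext_mul_balanced_l z) _ _.
Qed.

Lemma ext_mulDr : right_distributive ext_mul +%R.
Proof.
move=> x y z; apply: tensor_valueDf => k a.
exact: tensor_value_additive (ext_mul_balanced_r k a) _ _.
Qed.

Lemma ext_mul_pure (k l : K) (a b : A) :
  ext_mul (pure k a) (pure l b) = pure (k * l) (a ** b).
Proof.
rewrite /ext_mul (tensor_value_pure (ext_mul_balanced_l _)).
exact: tensor_value_pure (ext_mul_balanced_r _ _) _ _.
Qed.

Lemma ext_ind (Q : scalar_extension -> Prop) :
  Q 0 -> (forall x y, Q x -> Q y -> Q (x + y)) ->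
  (forall (k : K) (a : A), Q (pure k a)) -> forall x, Q x.
Proof. exact: tensor_ind. Qed.

Lemma morphD0 (U V : zmodType) (f : U -> V) :
  {morph f : x y / x + y} -> f 0 = 0.
Proof. by move=> fD; apply: (addrI (f 0)); rewrite -fD !addr0. Qed.

Lemma ext_scale0 k : ext_scale k 0 = 0.
Proof. exact: morphD0 (ext_scaleD k). Qed.

Lemma ext_mul0l y : ext_mul 0 y = 0.
Proof. by apply: (morphD0 (f := ext_mul^~ y)) => x z; exact: ext_mulDl. Qed.

Lemma ext_mul0r x : ext_mul x 0 = 0.
Proof. by apply: (morphD0 (f := ext_mul x)) => y z; exact: ext_mulDr. Qed.

Lemma ext_scaleA k l x : ext_scale k (ext_scale l x) = ext_scale (k * l) x.
Proof.
elim/ext_ind: x => [|x y IHx IHy|m a]; first by rewrite !ext_scale0.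
  by rewrite !ext_scaleD IHx IHy.
by rewrite !ext_scale_pure mulrA.
Qed.

Lemma ext_scale1 : left_id 1 ext_scale.
Proof.
move=> x; elim/ext_ind: x => [|x y IHx IHy|m a]; first by rewrite ext_scale0.
  by rewrite ext_scaleD IHx IHy.
by rewrite ext_scale_pure mul1r.
Qed.

Lemma ext_scaleDl x : {morph ext_scale^~ x : k l / k + l}.
Proof.
have [bDl _ _] := @pure_balanced S K A.
by move=> k l; apply: tensor_valueDf => m a; rewrite mulrDl bDl.
Qed.

HB.instance Definition _ := GRing.Zmodule_isLmodule.Build K scalar_extension
  ext_scaleA ext_scale1 ext_scaleD ext_scaleDl.

Lemma ext_mulA : associative ext_mul.
Proof.
move=> x y z; elim/ext_ind: x => [|x x' IHx IHx'|k a].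
- by rewrite !ext_mul0l.
- by rewrite !ext_mulDl IHx IHx'.
elim/ext_ind: y => [|y y' IHy IHy'|l b].
- by rewrite !(ext_mul0l, ext_mul0r).
- by rewrite !(ext_mulDl, ext_mulDr) IHy IHy'.
elim/ext_ind: z => [|z z' IHz IHz'|m c].
- by rewrite !ext_mul0r.
- by rewrite !ext_mulDr IHz IHz'.
by rewrite !ext_mul_pure mulrA numulA.
Qed.

Lemma ext_mulZl (k : K) x y : ext_mul (k *: x) y = k *: ext_mul x y.
Proof.
elim/ext_ind: x => [|x x' IHx IHx'|l a].
- by rewrite scaler0 ext_mul0l scaler0.
- by rewrite scalerDr !ext_mulDl scalerDr IHx IHx'.
elim/ext_ind: y => [|y y' IHy IHy'|m b].
- by rewrite !ext_mul0r scaler0.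
- by rewrite !ext_mulDr scalerDr IHy IHy'.
by rewrite [_ *: _]ext_scale_pure !ext_mul_pure [RHS]ext_scale_pure mulrA.
Qed.

Lemma ext_mulZr (k : K) x y : ext_mul x (k *: y) = k *: ext_mul x y.
Proof.
elim/ext_ind: x => [|x x' IHx IHx'|l a].
- by rewrite !ext_mul0l scaler0.
- by rewrite !ext_mulDl scalerDr IHx IHx'.
elim/ext_ind: y => [|y y' IHy IHy'|m b].
- by rewrite scaler0 ext_mul0r scaler0.
- by rewrite scalerDr !ext_mulDr scalerDr IHy IHy'.
by rewrite [_ *: _]ext_scale_pure !ext_mul_pure [RHS]ext_scale_pure mulrCA.
Qed.

HB.instance Definition _ := Lmodule_isNuAlgebra.Build K scalar_extension
  ext_mulA ext_mulDl ext_mulDr ext_mulZl ext_mulZr.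

Lemma scale_pureE (k l : K) (a : A) :
  k *: (pure l a : scalar_extension) = pure (k * l) a.
Proof. exact: ext_scale_pure. Qed.

Lemma mul_pureE (k l : K) (a b : A) :
  (pure k a : scalar_extension) ** pure l b = pure (k * l) (a ** b).
Proof. exact: ext_mul_pure. Qed.

End ScalarExtension.

Notation "K \otimes_ S A" := (@scalar_extension S K A)
  (at level 40, S at level 0, A at level 9) : type_scope.

(* MathComp makes [zmodule R] only a Z-module; it is made a Z-algebra here. *)
Section IntAlgebra.
Variable R : comNzRingType.

HB.instance Definition _ := GRing.ComNzRing.on (zmodule R).

Fact zmodule_scaleAl (n : int) (x y : zmodule R) : n *: (x * y) = n *: x * y.
Proof. by rewrite !scalezrE mulrzAl. Qed.

HB.instance Definition _ :=
  GRing.Lmodule_isLalgebra.Build int (zmodule R) zmodule_scaleAl.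

Fact zmodule_scaleAr (n : int) (x y : zmodule R) : n *: (x * y) = x * (n *: y).
Proof. by rewrite !scalezrE mulrzAr. Qed.

HB.instance Definition _ :=
  GRing.Lalgebra_isAlgebra.Build int (zmodule R) zmodule_scaleAr.
End IntAlgebra.

(* Main.v *)
From HB Require Import structures.
Require Import Defs.
From mathcomp Require Import all_boot all_algebra finfield.
From mathcomp Require Import cardinality fsbigop.
Set Implicit Arguments.
Unset Strict Implicit.
Unset Printing Implicit Defensive.
Import GRing.Theory.
Local Open Scope ring_scope.

(** Both isomorphisms are instances of one base change statement, valid for
    every commutative ring [S] and every commutative unital [S]-algebra [K]:
    [L_K(E)] and the scalar extension to [K] of [L_S(E)] solve the same
    universal problem, because the Leavitt relations only involve the
    coefficients 0 and 1.

    In one direction, the elements [1 (x) v], [1 (x) e], [1 (x) e^*] form a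
    Leavitt family, so the universal property of [L_K(E)] gives a morphism [f]
    of [K]-algebras.  In the other direction, [L_K(E)] is an [S]-algebra by
    restriction of scalars, and its generators form a Leavitt family there; this
    gives a morphism [g] of [S]-algebras from [L_S(E)], which extends to the
    tensor product by [k (x) x |-> k g(x)].  The two maps are mutually inverse
    because morphisms of algebras out of a Leavitt path algebra are determined
    by the generators: over [K] this shows that one composite is the identity,
    and over [S] it shows [f (g x) = 1 (x) x], whence the other one is.
    The theorem is the case of [S] the integers or the prime field. *)

(** * Transport of Leavitt families *)

(** The two algebras may have different scalars: the Leavitt relations mention
    addition and multiplication only. *)
Lemma leavitt_family_morph (R S : pzRingType) (E : graph)
    (A : nuAlgType R) (B : nuAlgType S) (f : A -> B)
    (a : vertex E -> A) (b c : edge E -> A) :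
  {morph f : x y / x + y} -> {morph f : x y / x ** y} ->
  leavitt_family a b c -> leavitt_family (f \o a) (f \o b) (f \o c).
Proof.
move=> fD fM fam; have f0 := morphD0 fD.
split=> [v|v w vw|e|e|e|e|e e'|v rv] /=; rewrite -?fM.
- by rewrite (lf_idem fam).
- by rewrite (lf_orth fam vw).
- by rewrite (lf_source fam).
- by rewrite (lf_range fam).
- by rewrite (lf_ghost_range fam).
- by rewrite (lf_ghost_source fam).
- by rewrite (lf_ck1 fam); case: eqP.
have [_ fin_v] := rv.
rewrite (lf_ck2 fam rv) !fsbig_finite //= (big_morph f fD f0).
by apply: eq_bigr => e _; rewrite fM.
Qed.

(** * Restriction of scalars *)

Section RestrictScalars.
Variables (S : comPzRingType) (K : comAlgType S) (A : nuAlgType K).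

(** A copy of [A], so that its two module structures do not compete. *)
Definition restrict_scalars : Type := A.
Local Notation resA := restrict_scalars.
HB.instance Definition _ := GRing.Zmodule.on resA.

Definition restrict_scale (s : S) (x : resA) : resA := (s%:A : K) *: (x : A).

Fact restrict_scaleA s t x :
  restrict_scale s (restrict_scale t x) = restrict_scale (s * t) x.
Proof. by rewrite /restrict_scale scalerA -scalerAl mul1r scalerA. Qed.

Fact restrict_scale1 : left_id 1 restrict_scale.
Proof. by move=> x; rewrite /restrict_scale !scale1r. Qed.

Fact restrict_scaleDr : right_distributive restrict_scale +%R.
Proof. by move=> s x y; exact: scalerDr. Qed.

Fact restrict_scaleDl x : {morph restrict_scale^~ x : s t / s + t}.
Proof. by move=> s t; rewrite /restrict_scale !scalerDl. Qed.

HB.instance Definition _ := GRing.Zmodule_isLmodule.Build S resA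
  restrict_scaleA restrict_scale1 restrict_scaleDr restrict_scaleDl.

Fact restrict_mulZl (s : S) (x y : resA) :
  numul (s *: x : A) (y : A) = s *: (numul (x : A) y : resA) :> resA.
Proof. exact: numulZl. Qed.

Fact restrict_mulZr (s : S) (x y : resA) :
  numul (x : A) (s *: y : A) = s *: (numul (x : A) y : resA) :> resA.
Proof. exact: numulZr. Qed.

HB.instance Definition _ := Lmodule_isNuAlgebra.Build S resA
  (@numulA K A) (@numulDl K A) (@numulDr K A) restrict_mulZl restrict_mulZr.

Lemma restrict_scaleE (s : S) (x : resA) : s *: x = (s%:A : K) *: (x : A) :> A.
Proof. by []. Qed.

End RestrictScalars.

(** * Base change of Leavitt path algebras *)

Section BaseChange.
Variables (S : comPzRingType) (K : comAlgType S) (E : graph).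

Local Notation LS := (lpa S E).
Local Notation LK := (lpa K E).
Local Notation ext := (@scalar_extension S K LS).
Local Notation res A := (@restrict_scalars S K A).

(** The canonical map of [S]-algebras to the scalar extension; its values lie in
    the restriction of scalars so that it can be compared, by uniqueness of
    morphisms of [S]-algebras, with maps that factor through [L_K(E)]. *)
Definition ext_unit (x : LS) : res ext := pure (1 : K) x.

Fact ext_unit_linear : linear ext_unit.
Proof.
have [_ bDr bS] := @pure_balanced S K LS.
move=> s x y; rewrite /ext_unit bDr; congr (_ + _).
by rewrite restrict_scaleE scale_pureE mulr1 bS.
Qed.

HB.instance Definition _ :=
  GRing.isLinear.Build S LS (res ext) *:%R ext_unit ext_unit_linear.

Lemma ext_unitM : {morph ext_unit : x y / x ** y}.
Proof. by move=> x y; rewrite [RHS]mul_pureE mulr1. Qed.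

(** Balancedness is what lets an [S]-linear map into a [K]-module extend to the
    tensor product; it holds because [S] acts on the target through [K]. *)
Lemma extension_balanced (g : {linear LS -> res LK}) :
  balanced (fun (k : K) (x : LS) => k *: (g x : LK)).
Proof.
split=> [x k l|k x y|s k x]; first exact: scalerDl.
  by rewrite linearD scalerDr.
by rewrite linearZ /= restrict_scaleE scalerA -scalerAr mulr1.
Qed.

(** Every use of [lpa_lift_unique] below compares two morphisms that agree on
    the generators, over [K] for [h \o f = id] and over [S] for
    [f \o g = 1 (x) _]; a tensor [k (x) x] is [k *: (1 (x) x)], so the second
    identity suffices for [f \o h = id]. *)
Theorem lpa_base_change : nualg_isomorphic LK ext.
Proof.
have fam1 : leavitt_family (A := ext) (ext_unit \o @lpa_vertex S E)
    (ext_unit \o @lpa_edge S E) (ext_unit \o @lpa_ghost S E).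
  apply: (leavitt_family_morph (B := ext)) (lpa_leavitt S E).
    exact: (linearD ext_unit).
  exact: ext_unitM.
have [f [fM fv fe fg]] := lpa_lift fam1.
have famK : leavitt_family (A := res LK)
    (@lpa_vertex K E) (@lpa_edge K E) (@lpa_ghost K E).
  have idD : {morph (fun x : LK => x : res LK) : x y / x + y} by [].
  have idM : {morph (fun x : LK => x : res LK) : x y / x ** y} by [].
  exact: leavitt_family_morph idD idM (lpa_leavitt K E).
have [g [gM gv ge gg]] := lpa_lift famK.
have gb := extension_balanced g.
pose h : ext -> LK := tensor_value (fun k x => k *: (g x : LK)).
have h_pure k x : h (pure k x) = k *: (g x : LK) := tensor_value_pure gb k x.
have hD : {morph h : x y / x + y} := tensor_value_additive gb.
have h0 : h 0 = 0 := morphD0 hD.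
have hZ k x : h (k *: x) = k *: h x.
  elim/ext_ind: x => [|x y IHx IHy|l x]; first by rewrite scaler0 h0 scaler0.
    by rewrite scalerDr !hD IHx IHy scalerDr.
  by rewrite scale_pureE !h_pure scalerA.
have hM : {morph h : x y / x ** y}.
  move=> x y; elim/ext_ind: x => [|x x' IHx IHx'|k a].
  (* A product with 0 vanishes in LK because 0 = 0 *: 0 and scalars move out. *)
  - by rewrite [0 ** y]ext_mul0l h0 -[in RHS](scale0r 0) numulZl scale0r.
  - by rewrite numulDl !hD IHx IHx' numulDl.
  elim/ext_ind: y => [|y y' IHy IHy'|l b].
  - by rewrite [_ ** 0]ext_mul0r h0 -[in RHS](scale0r 0) numulZr scale0r.
  - by rewrite numulDr !hD IHy IHy' numulDr.
  by rewrite mul_pureE !h_pure gM numulZl numulZr scalerA.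
have hlin : linear h by move=> k x y; rewrite hD hZ.
pose hL : {linear ext -> LK} :=
  HB.pack h (GRing.isLinear.Build K ext LK *:%R h hlin).
have fK : cancel f h.
  apply: (lpa_lift_unique (f := hL \o f) (g := idfun)) => //= [x y|v|e|e].
  - exact: etrans (congr1 h (fM x y)) (hM _ _).
  - by rewrite fv h_pure scale1r gv.
  - by rewrite fe h_pure scale1r ge.
  - by rewrite fg h_pure scale1r gg.
have fr_lin : linear (f : res LK -> res ext).
  by move=> s x y; exact: (linearP f (s%:A : K) x y).
pose fr : {linear res LK -> res ext} :=
  HB.pack (f : res LK -> res ext)
    (GRing.isLinear.Build S (res LK) (res ext) *:%R f fr_lin).
have fgE x : f (g x) = pure 1 x.
  apply: (lpa_lift_unique (f := fr \o g) (g := ext_unit)) => /= [y z||v|e|e].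
  - exact: etrans (congr1 f (gM y z)) (fM _ _).
  - exact: ext_unitM.
  - by rewrite gv; exact: fv.
  - by rewrite ge; exact: fe.
  - by rewrite gg; exact: fg.
exists f => //; exists h => // x.
elim/ext_ind: x => [|x y IHx IHy|k x]; first by rewrite h0 linear0.
  by rewrite hD linearD IHx IHy.
by rewrite h_pure linearZ /= fgE scale_pureE mulr1.
Qed.

End BaseChange.

Theorem corollary8p2 (E : graph) (K : fieldType) :
  nualg_isomorphic (lpa K E)
    (zmodule K \otimes_int (lpa int E) : nuAlgType (zmodule K)) /\
  (forall (p : nat) (charK : p \in [pchar K]),
    nualg_isomorphic (lpa K E)
      (pPrimeCharType charK \otimes_'F_p (lpa 'F_p E)
        : nuAlgType (pPrimeCharType charK))).
Proof.
split=> [|p charK]; first exact: (@lpa_base_change int (zmodule K) E).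
exact: (@lpa_base_change 'F_p (pPrimeCharType charK) E).
Qed.
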